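(* Let $p \geqslant 2$ be an integer. The standard model $(\mathbb N, S, +, 0, V_p)$ satisfies every axiom of the theory $\mathsf{T_{BA}}_p$; equivalently, $\mathsf{BA}_p \vDash \mathsf{T_{BA}}_p$.
   Context: Fix an integer $p \geqslant 2$. The language consists of a constant $0$, a unary function symbol $S$, a binary function symbol $+$ and a unary function symbol $V_p$. In the standard model $(\mathbb N, S, +, 0, V_p)$, $S(n)=n+1$, $+$ is addition, $V_p(0)=0$ and, for $n>0$, $V_p(n)=p^k$ where $p^k \mid n$ and $p^{k+1}\nmid n$. $\mathsf{BA}_p$ denotes the complete first-order theory of this standard model. For $n\in\mathbb N$, $\underline n$ denotes the numeral $S^n(0)$; for a positive integer $n$ and a term $t$, $n t$ denotes the term $(\dots((t+t)+t)\dots)$ with $n$ occurrences of $t$. Iterated exponentials are defined by $2^k_0=k$, $2^k_{m+1}=2^{2^k_m}$. For a formula $\varphi$, $|\varphi|$ is its length (number of symbols). $x \leqslant y$ abbreviates $\exists z\,(x+z=y)$ for a fresh variable $z$, and $\exists x \leqslant t\, \varphi$ abbreviates $\exists x\,(x\leqslant t \wedge \varphi)$. The theory $\mathsf{T_{BA}}_p$ consists of the (universal closures of the) axioms: (S0) $Sx=Sy\to x=y$; (S1) $0\ne Sx$; (S2) $x=0\vee\exists y\,(x=Sy)$; (A0) $x+0=x$; (A1) $x+Sy=S(x+y)$; (V0) $V_p(0)=0$; (V1) $V_p(\underline 1)=\underline 1$; (V2) $V_p(p x)=p V_p(x)$; (V3) $\bigwedge_{i=1}^{p-1} V_p(p x+\underline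 i)=\underline 1$; and, for each formula $\varphi(x)$ with exactly one free variable, (Bound$_\varphi$) $\exists x\,\varphi(x)\to\exists x\leqslant \underline{n_\varphi}\,\varphi(x)$, where $n_\varphi=p^{2^3_{|\varphi|}}$. *)

(* Defs.v *)
From mathcomp Require Import all_boot.

Set Implicit Arguments.
Unset Strict Implicit.
Unset Printing Implicit Defensive.

Inductive term : Type :=
  | Var of nat
  | Zero
  | Succ of term
  | Add of term & term
  | Val of term.

(* All the usual connectives and both quantifiers are primitive symbols. *)
Inductive formula : Type :=
  | Eq of term & term
  | Neg of formula
  | And of formula & formula
  | Or of formula & formula
  | Imp of formula & formula
  | All of nat & formula
  | Ex of nat & formula.

Fixpoint term_vars (t : term) : seq nat :=
  match t with
  | Var x => [:: x]
  | Zero => [::]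
  | Succ t => term_vars t
  | Add t s => term_vars t ++ term_vars s
  | Val t => term_vars t
  end.

Fixpoint free_vars (A : formula) : seq nat :=
  match A with
  | Eq t s => term_vars t ++ term_vars s
  | Neg A => free_vars A
  | And A B | Or A B | Imp A B => free_vars A ++ free_vars B
  | All x A | Ex x A => [seq y <- free_vars A | y != x]
  end.

(* The length counts variables, constants, function symbols, =, connectives
   and quantifiers. Parentheses are not counted: any convention that counts
   them gives longer formulas, hence larger (weaker) bounds below. *)
Fixpoint term_length (t : term) : nat :=
  match t with
  | Var _ | Zero => 1
  | Succ t | Val t => (term_length t).+1
  | Add t s => (term_length t + term_length s).+1
  end.

Fixpoint formula_length (A : formula) : nat :=
  match A with
  | Eq t s => (term_length t + term_length s).+1
  | Neg A => (formula_length A).+1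
  | And A B | Or A B | Imp A B => (formula_length A + formula_length B).+1
  | All _ A | Ex _ A => (formula_length A).+2
  end.

Definition sentence (A : formula) : Prop := free_vars A = [::].

Definition closure (A : formula) : formula := foldr All A (undup (free_vars A)).

Record structure : Type := MkStructure {
  carrier :> Type;
  zero_of : carrier;
  succ_of : carrier -> carrier;
  add_of : carrier -> carrier -> carrier;
  val_of : carrier -> carrier
}.

Definition update (T : Type) (e : nat -> T) (x : nat) (a : T) : nat -> T :=
  fun y => if y == x then a else e y.

Fixpoint eval (M : structure) (e : nat -> M) (t : term) : M :=
  match t with
  | Var x => e x
  | Zero => zero_of M
  | Succ t => succ_of (eval e t)
  | Add t s => add_of (eval e t) (eval e s)
  | Val t => val_of (eval e t)
  end.

Fixpoint sat (M : structure) (e : nat -> M) (A : formula) : Prop :=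
  match A with
  | Eq t s => eval e t = eval e s
  | Neg A => ~ sat e A
  | And A B => sat e A /\ sat e B
  | Or A B => sat e A \/ sat e B
  | Imp A B => sat e A -> sat e B
  | All x A => forall a : M, sat (update e x a) A
  | Ex x A => exists a : M, sat (update e x a) A
  end.

Definition theory : Type := formula -> Prop.

Definition satisfies (M : structure) (A : formula) : Prop :=
  forall e : nat -> M, sat e A.

Definition models (M : structure) (T : theory) : Prop :=
  forall A, T A -> satisfies M A.

Definition entails (T U : theory) : Prop :=
  forall M : structure, models M T -> models M U.

(* [logn] is only meaningful for a prime base, and p may be composite; the
   exponents k with p ^ k %| n > 0 satisfy k <= n as soon as 1 < p. *)
Definition Vp (p n : nat) : nat :=
  if n == 0 then 0 else p ^ (\max_(k < n.+1 | p ^ k %| n) k).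

Lemma VpE (p n k : nat) :
  1 < p -> 0 < n -> p ^ k %| n -> ~~ (p ^ k.+1 %| n) -> Vp p n = p ^ k.
Proof.
move=> p_gt1 n_gt0 dvd_k ndvd_k; rewrite /Vp eqn0Ngt n_gt0 /=; congr (_ ^ _).
have k_lt : k < n.+1.
  by rewrite ltnS (leq_trans (ltnW (ltn_expl k p_gt1))) // dvdn_leq.
apply/eqP; rewrite eqn_leq (leq_bigmax_cond (Ordinal k_lt)) // andbT.
apply/bigmax_leqP => i dvd_i; rewrite leqNgt; apply: contra ndvd_k => lt_ki.
exact: dvdn_trans (dvdn_exp2l p lt_ki) dvd_i.
Qed.

Definition standard (p : nat) : structure := @MkStructure nat 0 succn addn (Vp p).

Definition BA (p : nat) : theory :=
  fun A => sentence A /\ satisfies (standard p) A.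

Definition numeral (n : nat) : term := iter n Succ Zero.

(* (... ((t + t) + t) ...) with n occurrences of t, for n > 0. *)
Definition nmul (n : nat) (t : term) : term := iter n.-1 (Add^~ t) t.

Definition Le (t s : term) : formula :=
  let z := (\max_(y <- term_vars t ++ term_vars s) y).+1 in
  Ex z (Eq (Add t (Var z)) s).

Definition ExLe (x : nat) (t : term) (A : formula) : formula :=
  Ex x (And (Le (Var x) t) A).

(* F 1 /\ ... /\ F n, for n > 0. *)
Definition bigAnd (n : nat) (F : nat -> formula) : formula :=
  foldl (fun A i => And A (F i)) (F 1) (iota 2 n.-1).

Fixpoint tower (k m : nat) : nat :=
  if m is m'.+1 then 2 ^ tower k m' else k.

Definition bound (p : nat) (A : formula) : nat :=
  p ^ tower 3 (formula_length A).

Local Notation x := (Var 0).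
Local Notation y := (Var 1).

Inductive TBA_axiom (p : nat) : formula -> Prop :=
  | S0 : TBA_axiom p (Imp (Eq (Succ x) (Succ y)) (Eq x y))
  | S1 : TBA_axiom p (Neg (Eq Zero (Succ x)))
  | S2 : TBA_axiom p (Or (Eq x Zero) (Ex 1 (Eq x (Succ y))))
  | A0 : TBA_axiom p (Eq (Add x Zero) x)
  | A1 : TBA_axiom p (Eq (Add x (Succ y)) (Succ (Add x y)))
  | V0 : TBA_axiom p (Eq (Val Zero) Zero)
  | V1 : TBA_axiom p (Eq (Val (numeral 1)) (numeral 1))
  | V2 : TBA_axiom p (Eq (Val (nmul p x)) (nmul p (Val x)))
  | V3 : TBA_axiom p (bigAnd p.-1 (fun i =>
           Eq (Val (Add (nmul p x) (numeral i))) (numeral 1)))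
  | Bound (A : formula) (v : nat) : free_vars A =i [:: v] ->
      TBA_axiom p (Imp (Ex v A) (ExLe v (numeral (bound p A)) A)).

Definition TBA (p : nat) : theory :=
  fun B => exists2 A, TBA_axiom p A & B = closure A.

(* Main.v *)
Require Import Defs.
From mathcomp Require Import all_boot.
From mathcomp Require Import zify.

(** Read assignments in base p, least significant digit first, all variables
    in parallel.  If e = d + p e' with d a tuple of digits, the value of a term
    at e is a digit depending only on d plus p times the value at e' of a
    residual term function; a term t has at most 2 ^ |t| such residuals, since
    a sum only has to remember a carry and V_p only whether a nonzero digit was
    met.  Consequently the truth of a formula A at e is decided by an automaton:
    connectives are products, and a quantifier is the subset construction, which
    costs one exponential.  Hence A has at most 2^3_|A| states, and if its only
    free variable has a witness with more digits than that, two prefixes of the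
    witness lead to the same state and cutting out the digits between them
    gives a smaller witness. *)

Set Implicit Arguments.
Unset Strict Implicit.
Unset Printing Implicit Defensive.

(** * Transducers and automata on base-[p] digits *)

(** A letter [d] gives a digit to every variable, relevant or not, so all terms and formulas are
    read over one alphabet. *)
Definition shift (p : nat) (d e : nat -> nat) : nat -> nat :=
  fun i => d i + p * e i.

(* Quantifying over all e' pointwise equal to the shifted assignment, here and
   in [automaton], avoids functional extensionality. *)
Record transducer (p : nat) := Transducer {
  tstate :> finType;
  value : tstate -> (nat -> nat) -> nat;
  output : tstate -> (nat -> nat) -> nat;
  tstep : tstate -> (nat -> nat) -> tstate;
  outputP : forall q d, (forall i, d i < p) -> output q d < p;
  tstepP : forall q d e e', (forall i, d i < p) -> e' =1 shift p d e ->
    value q e' = output q d + p * value (tstep q d) e }.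

Definition sequential (p : nat) (f : (nat -> nat) -> nat) (n : nat) : Prop :=
  exists (M : transducer p) (q : M), #|M| <= n /\ value q =1 f.

(** There is no set of final states: [accepts q] is the property of the remaining assignment that
    [q] stands for, and only the number of states is controlled. *)
Record automaton (p : nat) := Automaton {
  astate :> finType;
  accepts : astate -> (nat -> nat) -> Prop;
  astep : astate -> (nat -> nat) -> astate;
  astepP : forall q d e e', (forall i, d i < p) -> e' =1 shift p d e ->
    (accepts (astep q d) e <-> accepts q e') }.

Definition recognizable (p : nat) (P : (nat -> nat) -> Prop) (n : nat) : Prop :=
  exists (M : automaton p) (q : M),
    #|M| <= n /\ forall e, accepts q e <-> P e.

Lemma recognizableW p P m n : m <= n -> recognizable p P m -> recognizable p P n.
Proof.
by move=> le_mn [M [q [cM MP]]]; exists M, q; split=> //; apply: leq_trans le_mn.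
Qed.

(** * Transducers for terms *)

(** This recursion on the lowest digit makes [Vp] computable with finite memory and also yields the
    axioms V1, V2 and V3. *)
Lemma Vp_step p c n : 1 < p -> c < p ->
  Vp p (c + p * n) = if c == 0 then p * Vp p n else 1.
Proof.
move=> p_gt1 c_lt; have p_gt0 := ltnW p_gt1.
case: eqP => [->|/eqP c_neq0]; last first.
  rewrite -(expn0 p); apply: VpE; rewrite ?dvd1n //; first by lia.
  rewrite expn1 -[c + _]addnC dvdn_addr ?dvdn_mulr //.
  by rewrite gtnNdvd // lt0n.
rewrite add0n; case: (posnP n) => [->|n_gt0]; first by rewrite !muln0.
have [k dvd_k ndvd_k]: exists2 k, p ^ k %| n & ~~ (p ^ k.+1 %| n).
  have ex0 : exists k, p ^ k %| n by exists 0; rewrite expn0 dvd1n.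
  have bd k : p ^ k %| n -> k <= n.
    by move/(dvdn_leq n_gt0); apply: leq_trans; rewrite ltnW // ltn_expl.
  case: (ex_maxnP ex0 bd) => k dvd_k max_k; exists k => //.
  by apply/negP => /max_k; rewrite ltnn.
rewrite (VpE p_gt1 n_gt0 dvd_k ndvd_k) -expnS; apply: VpE => //.
- by rewrite muln_gt0 p_gt0.
- by rewrite expnS dvdn_pmul2l.
- by rewrite expnS dvdn_pmul2l.
Qed.

Lemma sequential_var p x : sequential p (fun e => e x) 1.
Proof.
unshelve eexists
  (@Transducer p unit (fun _ e => e x) (fun _ d => d x) (fun q _ => q) _ _).
- by [].
- by move=> q d e e' _ /= ->.
by exists tt; split=> //=; rewrite card_unit.
Qed.

Lemma sequential_zero p : 0 < p -> sequential p (fun=> 0) 1.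
Proof.
move=> p_gt0.
unshelve eexists
  (@Transducer p unit (fun _ _ => 0) (fun _ _ => 0) (fun q _ => q) _ _).
- by [].
- by move=> q d e e' _ _; rewrite muln0.
by exists tt; split=> //=; rewrite card_unit.
Qed.

(** The third state component is the carry. An arbitrary initial carry [b] lets successor be treated
    as a sum with zero and carry 1. *)
Lemma sequential_add p f g (b : bool) m n : 0 < p ->
  sequential p f m -> sequential p g n ->
  sequential p (fun e => f e + g e + b) (2 * (m * n)).
Proof.
move=> p_gt0 [M [q [cM Mf]]] [M' [q' [cM' Mg]]].
pose total (s : M * M' * bool) d := output s.1.1 d + output s.1.2 d + s.2.
unshelve eexists (@Transducer p (M * M' * bool)%type
  (fun s e => value s.1.1 e + value s.1.2 e + s.2)
  (fun s d => total s d %% p)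
  (fun s d => (tstep s.1.1 d, tstep s.1.2 d, p <= total s d)) _ _).
- by move=> s d _; rewrite ltn_mod.
- case=> [[s s'] c] d e e' d_lt De' /=.
  rewrite (tstepP s d_lt De') (tstepP s' d_lt De').
  have := outputP s d_lt; have := outputP s' d_lt.
  rewrite /total /=; set o := output s d; set o' := output s' d => o'_lt o_lt.
  have c_le1 : c <= 1 by case: c.
  case: leqP => [le_p|lt_p]; last by rewrite modn_small //; lia.
  (* Two digits and a carry total less than [2 * p], so reduction modulo [p] subtracts [p] only
     once. *)
  have -> : (o + o' + c) %% p = o + o' + c - p.
    by rewrite -{1}(subnK le_p) modnDr modn_small //; lia.
  by rewrite !mulnDr muln1; lia.
exists (q, q', b); split=> /= [|e]; last by rewrite Mf Mg.
by rewrite !card_prod card_bool mulnC leq_pmul2l // leq_mul.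
Qed.

(** For a positive argument the only nonzero digit of the result is a 1, at the place of the lowest
    nonzero digit of the argument. [None] is the state after that place, where only zeros are
    output. *)
Lemma sequential_Vp p f n : 1 < p ->
  sequential p f n -> sequential p (fun e => Vp p (f e)) n.+1.
Proof.
move=> p_gt1 [M [q [cM Mf]]].
unshelve eexists (@Transducer p (option M)
  (fun s e => if s is Some s then Vp p (value s e) else 0)
  (fun s d => if s is Some s then output s d != 0 else 0)
  (fun s d => if s is Some s then
                if output s d == 0 then Some (tstep s d) else None
              else None) _ _).
- by move=> [s|] d _ /=; [case: (_ != _)|]; lia.
- move=> [s|] d e e' d_lt De' /=; last by rewrite muln0.
  rewrite (tstepP s d_lt De') (Vp_step _ p_gt1 (outputP s d_lt)).
  by case: eqP => //=; rewrite muln0.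
by exists (Some q); split=> /= [|e]; rewrite ?card_option ?Mf.
Qed.

Lemma sequential_ext p f g m n : f =1 g -> m <= n ->
  sequential p f m -> sequential p g n.
Proof.
move=> Efg le_mn [M [q [cM Mf]]]; exists M, q.
by split=> [|e]; [apply: leq_trans le_mn | rewrite Mf].
Qed.

Lemma sequential_term p t : 1 < p ->
  sequential p (fun e => @eval (standard p) e t) (2 ^ term_length t).
Proof.
move=> p_gt1; have p_gt0 := ltnW p_gt1.
elim: t => [x||t IHt|t IHt s IHs|t IHt] /=.
- by apply: sequential_ext (sequential_var p x).
- by apply: sequential_ext (sequential_zero p_gt0).
- apply: sequential_ext (sequential_add true p_gt0 IHt (sequential_zero p_gt0)).
    by move=> e; rewrite addn0 addn1.
  by rewrite muln1 expnS.
- apply: sequential_ext (sequential_add false p_gt0 IHt IHs).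
    by move=> e; rewrite addn0.
  by rewrite expnS expnD.
- apply: sequential_ext (sequential_Vp p_gt1 IHt) => //.
  by rewrite expnS mul2n -addnn -addn1 leq_add2l expn_gt0.
Qed.

(** * Automata for formulas *)

(** The two outputs are compared digit by digit; [None] is the rejecting sink entered at the first
    difference. *)
Lemma recognizable_eq p f g m n : 0 < p ->
  sequential p f m -> sequential p g n ->
  recognizable p (fun e => f e = g e) (m * n).+1.
Proof.
move=> p_gt0 [M [q [cM Mf]]] [M' [q' [cM' Mg]]].
unshelve eexists (@Automaton p (option (M * M'))
  (fun s e => if s is Some (s, s') then value s e = value s' e else False)
  (fun s d => if s is Some (s, s') then
      if output s d == output s' d then Some (tstep s d, tstep s' d) else None
    else None) _).
- move=> [[s s']|] d e e' d_lt De' //=.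
  rewrite (tstepP s d_lt De') (tstepP s' d_lt De').
  have := outputP s d_lt; have := outputP s' d_lt.
  set o := output s d; set o' := output s' d => o'_lt o_lt.
  case: eqP => [->|ne_o].
    by split=> [->//|/addnI/eqP]; rewrite eqn_pmul2l // => /eqP.
  split=> // E; case: ne_o.
  move/(congr1 (modn^~ p)): E.
  by rewrite ![_ + p * _]addnC ![p * _]mulnC !modnMDl !modn_small.
exists (Some (q, q')); split=> /= [|e]; last by rewrite Mf Mg.
by rewrite card_option card_prod ltnS leq_mul.
Qed.

Lemma recognizable_neg p P n :
  recognizable p P n -> recognizable p (fun e => ~ P e) n.
Proof.
move=> [M [q [cM MP]]].
unshelve eexists (@Automaton p M (fun s e => ~ accepts s e) (@astep p M) _).
  by move=> s d e e' d_lt De' /=; rewrite (astepP s d_lt De').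
by exists q; split=> //= e; rewrite MP.
Qed.

Lemma recognizable_binary p (op : Prop -> Prop -> Prop) P R m n :
    (forall A A' B B', (A <-> A') -> (B <-> B') -> (op A B <-> op A' B')) ->
  recognizable p P m -> recognizable p R n ->
  recognizable p (fun e => op (P e) (R e)) (m * n).
Proof.
move=> op_iff [M [q [cM MP]]] [M' [q' [cM' MR]]].
unshelve eexists (@Automaton p (M * M')%type
  (fun s e => op (accepts s.1 e) (accepts s.2 e))
  (fun s d => (astep s.1 d, astep s.2 d)) _).
  by move=> [s s'] d e e' d_lt De' /=; apply: op_iff; apply: astepP.
exists (q, q'); split=> /= [|e]; last exact: op_iff.
by rewrite card_prod leq_mul.
Qed.

Lemma update_shift p d e e' x c a : e' =1 shift p d e ->
  update e' x (c + p * a) =1 shift p (update d x c) (update e x a).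
Proof. by move=> De' i; rewrite /shift /update; case: eqP => // _; rewrite De'. Qed.

Lemma update_lt p d x c : (forall i, d i < p) -> c < p ->
  forall i, update d x c i < p.
Proof. by move=> d_lt c_lt i; rewrite /update; case: eqP. Qed.

(** Determinises the automaton that guesses the digit of [x]: the digit supplied by [d] is
    overwritten by every possible one. *)
Definition subset_step p (M : automaton p) x (S : {set M}) (d : nat -> nat) :=
  \bigcup_(q in S) \bigcup_(c < p) [set astep q (update d x c)].

Lemma subset_stepP p (M : automaton p) x (S : {set M}) d q' :
  reflect (exists q c, [/\ q \in S, c < p & q' = astep q (update d x c)])
          (q' \in subset_step x S d).
Proof.
apply: (iffP bigcupP) => [[q qS /bigcupP[c _ /set1P ->]]|[q [c [qS c_lt ->]]]].
  by exists q, c.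
by exists q => //; apply/bigcupP; exists (Ordinal c_lt); rewrite ?inE.
Qed.

(** The rest of the witness is quantified inside the acceptance condition, so a witness longer than
    the other values needs no special care about leading zeros. *)
Lemma recognizable_ex p P x n : 0 < p ->
  recognizable p P n ->
  recognizable p (fun e => exists a, P (update e x a)) (2 ^ n).
Proof.
move=> p_gt0 [M [q [cM MP]]].
unshelve eexists (@Automaton p {set M}
  (fun S e => exists2 s, s \in S & exists a, accepts s (update e x a))
  (@subset_step p M x) _).
- move=> S d e e' d_lt De'; split=> /=.
    move=> [s' /subset_stepP[s [c [sS c_lt ->]]] [a]].
    rewrite (astepP s (update_lt x d_lt c_lt) (update_shift x c a De')) => acc.
    by exists s => //; exists (c + p * a).
  move=> [s sS [a acc]]; have c_lt : a %% p < p by rewrite ltn_mod.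
  exists (astep s (update d x (a %% p))).
    by apply/subset_stepP; exists s, (a %% p).
  exists (a %/ p).
  rewrite (astepP s (update_lt x d_lt c_lt) (update_shift x _ _ De')).
  by rewrite addnC mulnC -divn_eq.
exists [set q]; split=> /= [|e].
  by rewrite -cardsT -powersetT card_powerset cardsT leq_exp2l.
split=> [[s /set1P -> [a /MP]]|[a /MP acc]]; first by exists a.
by exists q; rewrite ?inE //; exists a.
Qed.

(** The same subset construction with every state required to accept. Passing through a negated
    existential would call for double negation elimination in [Prop]. *)
Lemma recognizable_all p P x n : 0 < p ->
  recognizable p P n ->
  recognizable p (fun e => forall a, P (update e x a)) (2 ^ n).
Proof.
move=> p_gt0 [M [q [cM MP]]].
unshelve eexists (@Automaton p {set M}
  (fun S e => forall s, s \in S -> forall a, accepts s (update e x a))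
  (@subset_step p M x) _).
- move=> S d e e' d_lt De'; split=> /= accS.
    move=> s sS a; have c_lt : a %% p < p by rewrite ltn_mod.
    rewrite (divn_eq a p) addnC mulnC.
    rewrite -(astepP s (update_lt x d_lt c_lt) (update_shift x _ _ De')).
    by apply: accS; apply/subset_stepP; exists s, (a %% p).
  move=> s' /subset_stepP[s [c [sS c_lt ->]]] a.
  rewrite (astepP s (update_lt x d_lt c_lt) (update_shift x _ _ De')).
  exact: accS.
exists [set q]; split=> /= [|e].
  by rewrite -cardsT -powersetT card_powerset cardsT leq_exp2l.
split=> [acc a|acc s /set1P -> a]; last exact/MP.
by apply/MP/acc; rewrite inE.
Qed.

(** * State counts against iterated exponentials *)

Lemma ltn_tower n k : n < tower k.+1 n.
Proof. by elim: n => //= n IHn; apply: leq_ltn_trans IHn (ltn_expl _ _). Qed.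

Lemma leq_tower k m n : m <= n -> tower k m <= tower k n.
Proof.
move=> /subnK <-; elim: (n - m) => //= i IHi.
exact: leq_trans IHi (ltnW (ltn_expl _ _)).
Qed.

Lemma expn2_tower n : 2 ^ n <= tower 3 n.
Proof. by case: n => //= n; rewrite leq_exp2l // ltn_tower. Qed.

Lemma leq_sqr_exp n : 3 < n -> n * n <= 2 ^ n.
Proof.
move=> /subnK <-; elim: (n - 4) => // i IHi.
by rewrite addSn expnS; move: IHi; nia.
Qed.

(** The product is at most the square of [tower 3 (m + n)], and one more exponential absorbs a
    square. Since [n * n <= 2 ^ n] fails at 3, the height [m + n] must be positive. *)
Lemma tower_mul m n : 0 < m -> 0 < n ->
  tower 3 m * tower 3 n <= tower 3 (m + n).+1.
Proof.
move=> m_gt0 n_gt0; set k := m + n.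
have t_k : 3 < tower 3 k.
  by apply: leq_trans (leq_tower 3 (_ : 1 <= k)) => //; rewrite addn_gt0 m_gt0.
apply: leq_trans (leq_sqr_exp t_k); apply: leq_mul; apply: leq_tower.
  exact: leq_addr.
exact: leq_addl.
Qed.

Lemma formula_length_gt0 A : 0 < formula_length A.
Proof. by case: A. Qed.

Lemma recognizable_sat p A : 1 < p ->
  recognizable p (fun e => @sat (standard p) e A) (tower 3 (formula_length A)).
Proof.
move=> p_gt1; have p_gt0 := ltnW p_gt1.
elim: A => [t s|A IHA|A IHA B IHB|A IHA B IHB|A IHA B IHB|x A IHA|x A IHA].
- apply: recognizableW (recognizable_eq p_gt0 (sequential_term t p_gt1)
    (sequential_term s p_gt1)).
  apply: leq_trans (expn2_tower _).
  by rewrite /= expnS expnD mul2n -addnn -addn1 leq_add2l muln_gt0 !expn_gt0.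
- by apply: recognizableW (recognizable_neg IHA); apply: leq_tower.
- apply: recognizableW (recognizable_binary (op := and) _ IHA IHB); last by tauto.
  exact/tower_mul/formula_length_gt0/formula_length_gt0.
- apply: recognizableW (recognizable_binary (op := or) _ IHA IHB); last by tauto.
  exact/tower_mul/formula_length_gt0/formula_length_gt0.
- apply: recognizableW
    (recognizable_binary (op := fun X Y => X -> Y) _ IHA IHB); last by tauto.
  exact/tower_mul/formula_length_gt0/formula_length_gt0.
(* A quantifier adds two to the length but costs one exponential, so a level of the tower is to
   spare. *)
- apply: recognizableW (recognizable_all x p_gt0 IHA).
  exact: (leq_tower 3 (leqnSn (formula_length A).+1)).
- apply: recognizableW (recognizable_ex x p_gt0 IHA).
  exact: (leq_tower 3 (leqnSn (formula_length A).+1)).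
Qed.

(** * Pumping in one variable *)

Definition point (v a : nat) : nat -> nat := update (fun=> 0) v a.

Fixpoint run p (M : automaton p) (q : M) (v a k : nat) : M :=
  if k is k'.+1 then astep (run q v a k') (point v ((a %/ p ^ k') %% p)) else q.

Lemma modn_expS p a k : a %% p ^ k.+1 = a %% p ^ k + p ^ k * (a %/ p ^ k %% p).
Proof.
apply: (@addnI (a %/ p ^ k.+1 * p ^ k.+1)); rewrite -divn_eq.
rewrite {1}(divn_eq a (p ^ k)) {1}(divn_eq (a %/ p ^ k) p) -divnMA -expnSr.
by rewrite mulnDl -mulnA -expnS [_ %% p * _]mulnC; lia.
Qed.

(** The continuation [b] is arbitrary because pumping glues a prefix of [a] to a tail starting at a
    later place. *)
Lemma runP p (M : automaton p) (q : M) v a k b : 0 < p ->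
  accepts (run q v a k) (point v b) <->
  accepts q (point v (a %% p ^ k + p ^ k * b)).
Proof.
move=> p_gt0; elim: k b => [|k IHk] b; first by rewrite expn0 modn1 mul1n.
have d_lt i : point v ((a %/ p ^ k) %% p) i < p.
  by apply: update_lt => //; rewrite ltn_mod.
have De : point v (a %/ p ^ k %% p + p * b)
    =1 shift p (point v (a %/ p ^ k %% p)) (point v b).
  by apply: update_shift => i; rewrite /shift muln0.
rewrite /= (astepP _ d_lt De) IHk modn_expS.
by rewrite mulnDr mulnA -expnSr addnA.
Qed.

Lemma pumping p (M : automaton p) (q : M) v a : 1 < p ->
  p ^ #|M| <= a -> accepts q (point v a) ->
  exists2 b, b < a & accepts q (point v b).
Proof.
move=> p_gt1 a_ge acc; have p_gt0 := ltnW p_gt1.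
pose f (i : 'I_(#|M|.+1)) := run q v a i.
have /injectivePn[i0 [j0 ne_ij Ef]] : ~~ injectiveb f.
  by apply/injectiveP => /leq_card; rewrite card_ord ltnn.
wlog lt_ij : i0 j0 ne_ij Ef / i0 < j0.
  move=> IH; case: (ltngtP i0 j0) => [|lt_ji|/val_inj E].
  - exact: IH.
  - by apply: (IH j0 i0) => //; rewrite eq_sym.
  - by rewrite E eqxx in ne_ij.
(* The digits of [a] at places [i0] to [j0 - 1] are cut out. *)
exists (a %% p ^ i0 + p ^ i0 * (a %/ p ^ j0)).
  rewrite [X in _ < X](divn_eq a (p ^ i0)) addnC [_ * p ^ i0]mulnC ltn_add2r.
  rewrite ltn_pmul2l ?expn_gt0 ?p_gt0 //.
  rewrite -(subnKC (ltnW lt_ij)) expnD divnMA ltn_Pdiv //.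
    by rewrite -(expn0 p) ltn_exp2l // subn_gt0.
  (* Size of [a] matters here: it has a nonzero digit at or above place [i0], so the cut strictly
     decreases it. *)
  rewrite divn_gt0 ?expn_gt0 ?p_gt0 //; apply: leq_trans a_ge.
  by rewrite leq_exp2l // -ltnS.
apply/runP => //; rewrite -/(f i0) Ef; apply/runP => //.
by rewrite addnC mulnC -divn_eq.
Qed.

Lemma small_witness p (M : automaton p) (q : M) v a : 1 < p ->
  accepts q (point v a) -> exists2 b, b < p ^ #|M| & accepts q (point v b).
Proof.
move=> p_gt1; elim/ltn_ind: a => a IHa acc.
case: (ltnP a (p ^ #|M|)) => [|a_ge]; first by exists a.
by have [b lt_ba] := pumping p_gt1 a_ge acc; apply: IHa.
Qed.

(** * Free variables and universal closures *)

Lemma eval_agree (M : structure) (e e' : nat -> M) t :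
  {in term_vars t, e =1 e'} -> eval e t = eval e' t.
Proof.
elim: t => [x||t IHt|t IHt s IHs|t IHt] //= Ee.
- by rewrite Ee ?inE.
- by rewrite IHt.
- by rewrite IHt ?IHs // => x x_in; rewrite Ee // mem_cat x_in ?orbT.
- by rewrite IHt.
Qed.

Lemma sat_agree (M : structure) (e e' : nat -> M) A :
  {in free_vars A, e =1 e'} -> (sat e A <-> sat e' A).
Proof.
have catP (s1 s2 : seq nat) (f g : nat -> M) : {in s1 ++ s2, f =1 g} ->
    {in s1, f =1 g} /\ {in s2, f =1 g}.
  by move=> E; split=> y y_in; rewrite E // mem_cat y_in ?orbT.
have updP (s : seq nat) (f g : nat -> M) x a :
    {in [seq y <- s | y != x], f =1 g} ->
    {in s, update f x a =1 update g x a}.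
  move=> E y ys; rewrite /update; case: eqP => // /eqP ne_yx.
  by rewrite E // mem_filter ne_yx.
elim: A e e' => [t s|A IHA|A IHA B IHB|A IHA B IHB|A IHA B IHB|x A IHA|x A IHA]
  e e' /=.
- by case/catP=> Et Es; rewrite (eval_agree Et) (eval_agree Es).
- by move/IHA => ->.
- by case/catP=> /IHA -> /IHB ->.
- by case/catP=> /IHA -> /IHB ->.
- by case/catP=> /IHA -> /IHB ->.
- by move=> E; split=> H a; move: (H a); apply (IHA _ _ (updP _ _ _ x a E)).
- by move=> E; split=> -[a H]; exists a; move: H; apply (IHA _ _ (updP _ _ _ x a E)).
Qed.

Lemma free_vars_foldr_All A s :
  free_vars (foldr All A s) = [seq y <- free_vars A | y \notin s].
Proof.
elim: s => /= [|x s ->]; first by rewrite filter_predT.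
by rewrite -filter_predI; apply: eq_filter => y; rewrite /= inE negb_or.
Qed.

Lemma closure_sentence A : sentence (Defs.closure A).
Proof.
rewrite /sentence /Defs.closure free_vars_foldr_All; apply/eqP.
rewrite -(negbK (_ == _)) -has_filter; apply/hasPn => y y_in.
by rewrite negbK mem_undup.
Qed.

Lemma satisfies_closure (M : structure) A :
  satisfies M A -> satisfies M (Defs.closure A).
Proof.
move=> satA; rewrite /Defs.closure; elim: (undup _) => //= x s IHs e a.
exact: IHs.
Qed.

(** * The axioms in the standard model *)

Lemma eval_numeral p e n : @eval (standard p) e (numeral n) = n.
Proof. by elim: n => //= n ->. Qed.

Lemma eval_nmul p e n t : 0 < n ->
  @eval (standard p) e (nmul n t) = n * @eval (standard p) e t.
Proof.
case: n => // n _; rewrite /nmul /=.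
by elim: n => [|n IHn] /=; rewrite ?mul1n // IHn [RHS]mulSn addnC.
Qed.

Lemma sat_bigAnd (M : structure) (e : nat -> M) n F :
  0 < n -> (forall i, 0 < i <= n -> sat e (F i)) -> sat e (bigAnd n F).
Proof.
move=> n_gt0 satF; rewrite /bigAnd.
have: sat e (F 1) by exact: satF.
have: forall i, i \in iota 2 n.-1 -> sat e (F i).
  by move=> i; rewrite mem_iota => i_in; apply: satF; lia.
elim: (iota _ _) (F 1) => //= i s IHs B sat_s satB; apply: IHs.
  by move=> j js; apply: sat_s; rewrite inE js orbT.
by split=> //; apply: sat_s; rewrite inE eqxx.
Qed.

(** Requiring a value independent of the assignment, as numerals have, avoids an argument that the
    bound [z] does not occur in [t]. *)
Lemma sat_Le_var p e v t : (forall e', @eval (standard p) e' t = eval e t) ->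
  @sat (standard p) e (Le (Var v) t) <-> e v <= @eval (standard p) e t.
Proof.
move=> t_const; rewrite /Le /=; set z := (\max_(y <- _) y).+1.
have ne_vz : (v == z) = false.
  by apply/negbTE; rewrite neq_ltn ltnS big_cons leq_maxl.
rewrite /update eqxx ne_vz; split=> [[c]|le_et].
  by rewrite t_const => <-; apply: leq_addr.
by exists (eval e t - e v); rewrite t_const; apply: subnKC.
Qed.

Lemma bound_axiom p A v : 1 < p -> free_vars A =i [:: v] ->
  satisfies (standard p) (Imp (Ex v A) (ExLe v (numeral (bound p A)) A)).
Proof.
move=> p_gt1 fvA e [a satA].
(* As [v] is the only free variable, all others may be set to 0, leaving a word made of the digits
   of [b]. *)
have to_point b : @sat (standard p) (update e v b) A
    <-> @sat (standard p) (point v b) A.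
  by apply: sat_agree => y; rewrite fvA inE => /eqP ->; rewrite /point /update eqxx.
have [M [q [cM MA]]] := recognizable_sat A p_gt1.
have [b b_lt /MA/to_point satb] : exists2 b, b < p ^ #|M| & accepts q (point v b).
  by apply: small_witness p_gt1 _; apply/MA/to_point/satA.
exists b; split=> //; apply/sat_Le_var => [e'|]; rewrite !eval_numeral //.
rewrite /update eqxx; apply: leq_trans (ltnW b_lt) _.
by rewrite leq_exp2l.
Qed.

Lemma standard_axiom p A : 1 < p -> TBA_axiom p A -> satisfies (standard p) A.
Proof.
move=> p_gt1; have p_gt0 := ltnW p_gt1.
case=> [||||||||| B v fvB] e /=; last exact: bound_axiom.
- by case.
- by [].
- by case E: (e 0 : nat) => [|n]; [left | right; exists n].
- exact: addn0.
- exact: addnS.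
- by [].
(* V1, V2 and V3 are [Vp_step] with lowest digit 1, 0 and [i] respectively. *)
- by have := Vp_step 0 p_gt1 p_gt1; rewrite muln0.
- by rewrite !eval_nmul //= -[p * e 0]add0n Vp_step.
- apply: sat_bigAnd => [|i i_in] /=; first by lia.
  rewrite eval_nmul // eval_numeral addnC Vp_step //=; last by lia.
  by case: eqP => //; lia.
Qed.

Theorem theorem4 (p : nat) (hp : 2 <= p) :
  models (standard p) (TBA p) /\ entails (BA p) (TBA p).
Proof.
have std : models (standard p) (TBA p).
  by move=> _ [A axA ->]; apply/satisfies_closure/standard_axiom.
(* Each closed axiom is a sentence true in the standard model, hence itself a member of [BA p]. *)
split=> // M M_BA B TB; apply: M_BA; split; last exact: std.
by case: TB => A _ ->; apply: closure_sentence.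
Qed.
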